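(* Let $(L,\forall)$ be a UMTL-algebra. Then the following statements are equivalent: (1) $(L,\forall)$ is semisimple; (2) $(L,\forall)$ is a subdirect product of a family of simple UMTL-algebras.
   Context: An MTL-algebra is a structure $(L,\wedge,\vee,\odot,\rightarrow,0,1)$ such that $(L,\wedge,\vee,0,1)$ is a bounded lattice (with order $\le$), $(L,\odot,1)$ is a commutative monoid, $x\odot y\leq z$ iff $x\leq y\rightarrow z$, and $(x\rightarrow y)\vee(y\rightarrow x)=1$ for all $x,y,z\in L$. A UMTL-algebra (MTL-algebra with a universal quantifier) is a structure $(L,\forall)=(L,\wedge,\vee,\odot,\rightarrow,0,1,\forall)$ where $(L,\wedge,\vee,\odot,\rightarrow,0,1)$ is an MTL-algebra and $\forall:L\to L$ is a unary operation satisfying, for all $x,y\in L$: (U1) $\forall x\leq x$; (U2) $\forall((x\rightarrow \forall y)\rightarrow \forall y)=(\forall x\rightarrow \forall y)\rightarrow \forall y$; (U3) $\forall(\forall x\rightarrow y)=\forall x\rightarrow\forall y$. A filter of $L$ is a nonempty subset $F$ with $1\in F$ and such that $x\in F$, $x\rightarrow y\in F$ imply $y\in F$; it is proper if $F\neq L$. A U-filter of $(L,\forall)$ is a filter $F$ of $L$ such that $x\in F$ implies $\forall x\in F$; a maximal U-filter is a proper U-filter not properly contained in any proper U-filter. $(L,\forall)$ is simple if it has exactly two U-filters, $\{1\}$ and $L$. A U-congruence of $(L,\forall)$ is a congruence of the MTL-algebra $L$ compatible with $\forall$; U-congruences correspond bijectively to U-filters via $\equiv\ \mapsto\{a\in L\mid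 a\equiv 1\}$. $(L,\forall)$ is semisimple if the intersection of all its maximal (proper) U-congruences is the identity congruence; equivalently, if the intersection $URad(L,\forall)$ of all maximal U-filters of $(L,\forall)$ equals $\{1\}$. Homomorphisms of UMTL-algebras (U-homomorphisms) are MTL-algebra homomorphisms commuting with $\forall$, and subdirect products are taken in this sense. *)

(* Defs.v *)
From HB Require Import structures.
From mathcomp Require Import all_boot all_order.
From mathcomp Require Import boolp classical_sets functions.

Set Implicit Arguments.
Unset Strict Implicit.
Unset Printing Implicit Defensive.

Import Order.TTheory.

Local Open Scope order_scope.

HB.mixin Record TBLattice_isMTL d L of Order.TBLattice d L := {
  odot : L -> L -> L;
  imp : L -> L -> L;
  odotA : associative odot;
  odotC : commutative odot;
  odot1x : left_id \top odot;
  odot_residuation : forall x y z : L, (odot x y <= z) = (x <= imp y z);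
  imp_prelinear : forall x y : L, imp x y `|` imp y x = \top
}.

#[short(type="mtlType")]
HB.structure Definition MTL d := {L of TBLattice_isMTL d L & Order.TBLattice d L}.

HB.mixin Record MTL_isUMTL d L of MTL d L := {
  univ : L -> L;
  univ_le : forall x : L, univ x <= x;
  univ_imp_imp : forall x y : L,
    univ (imp (imp x (univ y)) (univ y)) = imp (imp (univ x) (univ y)) (univ y);
  univ_imp : forall x y : L, univ (imp (univ x) y) = imp (univ x) (univ y)
}.

#[short(type="umtlType")]
HB.structure Definition UMTL d := {L of MTL_isUMTL d L & MTL d L}.

Section UMTLTheory.
Variables (d : Order.disp_t) (L : umtlType d).

Definition mtl_filter (F : set L) : Prop :=
  F \top /\ (forall x y : L, F x -> F (imp x y) -> F y).

Definition U_filter (F : set L) : Prop :=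
  mtl_filter F /\ (forall x : L, F x -> F (univ x)).

(* As an equality of sets of sets; the second conjunct makes the two
   U-filters distinct, so the one-element algebra is not simple. *)
Definition umtl_simple : Prop :=
  [set F | U_filter F]%classic = [set [set \top : L]; [set: L]]%classic /\
  [set \top : L]%classic <> [set: L]%classic.

(* A binary relation on L is represented by its graph. *)
Record U_congruence (E : set (L * L)) : Prop := {
  cong_refl : forall x, E (x, x);
  cong_sym : forall x y, E (x, y) -> E (y, x);
  cong_trans : forall x y z, E (x, y) -> E (y, z) -> E (x, z);
  cong_meet : forall x x' y y',
    E (x, x') -> E (y, y') -> E (x `&` y, x' `&` y');
  cong_join : forall x x' y y',
    E (x, x') -> E (y, y') -> E (x `|` y, x' `|` y');
  cong_odot : forall x x' y y',
    E (x, x') -> E (y, y') -> E (odot x y, odot x' y');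
  cong_imp : forall x x' y y',
    E (x, x') -> E (y, y') -> E (imp x y, imp x' y');
  cong_univ : forall x x', E (x, x') -> E (univ x, univ x')
}.

Definition proper_U_congruence (E : set (L * L)) : Prop :=
  U_congruence E /\ E <> [set: L * L]%classic.

Definition maximal_U_congruence (E : set (L * L)) : Prop :=
  proper_U_congruence E /\
  (forall E', proper_U_congruence E' -> ~ (E `<` E')%classic).

(* The intersection of the empty family is the total relation. *)
Definition umtl_semisimple : Prop :=
  (\bigcap_(E in [set E | maximal_U_congruence E]) E)%classic = diagonal.

End UMTLTheory.

Arguments umtl_simple {d} L.
Arguments umtl_semisimple {d} L.

Record U_hom (d d' : Order.disp_t) (L : umtlType d) (M : umtlType d')
    (f : L -> M) : Prop := {
  hom_bot : f \bot = \bot;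
  hom_top : f \top = \top;
  hom_meet : {morph f : x y / x `&` y};
  hom_join : {morph f : x y / x `|` y};
  hom_odot : {morph f : x y / odot x y};
  hom_imp : {morph f : x y / imp x y};
  hom_univ : {morph f : x / univ x}
}.

Definition umtl_prod (d : Order.disp_t) (I : Type) (A : I -> umtlType d) : Type :=
  forall i, A i.

Section Product.
Variables (d : Order.disp_t) (I : Type) (A : I -> umtlType d).
Local Notation P := (umtl_prod A).
Implicit Types f g h : P.

HB.instance Definition _ := gen_eqMixin P.
HB.instance Definition _ := gen_choiceMixin P.

Definition prod_le f g : bool := `[< forall i, f i <= g i >].
Definition prod_meet f g : P := fun i => f i `&` g i.
Definition prod_join f g : P := fun i => f i `|` g i.
Definition prod_bot : P := fun=> \bot.
Definition prod_top : P := fun=> \top.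
Definition prod_odot f g : P := fun i => odot (f i) (g i).
Definition prod_imp f g : P := fun i => imp (f i) (g i).
Definition prod_univ f : P := fun i => univ (f i).

Fact prod_le_refl : reflexive prod_le.
Proof. by move=> f; apply/asboolP. Qed.

Fact prod_le_anti : antisymmetric prod_le.
Proof.
move=> f g /andP[/asboolP fg /asboolP gf]; apply: functional_extensionality_dep.
by move=> i; apply/le_anti; rewrite fg gf.
Qed.

Fact prod_le_trans : transitive prod_le.
Proof.
move=> g f h /asboolP fg /asboolP gh; apply/asboolP => i.
exact: le_trans (fg i) (gh i).
Qed.

HB.instance Definition _ :=
  Order.Le_isPOrder.Build d P prod_le_refl prod_le_anti prod_le_trans.

Fact prod_lexI f g h : (f <= prod_meet g h) = (f <= g) && (f <= h).
Proof.
apply/asboolP/andP => [fgh|[/asboolP fg /asboolP fh] i].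
  by split; apply/asboolP => i; move: (fgh i); rewrite lexI => /andP[].
by rewrite lexI fg fh.
Qed.

Fact prod_leUx f g h : (prod_join f g <= h) = (f <= h) && (g <= h).
Proof.
apply/asboolP/andP => [fgh|[/asboolP fh /asboolP gh] i].
  by split; apply/asboolP => i; move: (fgh i); rewrite leUx => /andP[].
by rewrite leUx fh gh.
Qed.

HB.instance Definition _ := Order.POrder_isMeetSemilattice.Build d P prod_lexI.
HB.instance Definition _ := Order.POrder_isJoinSemilattice.Build d P prod_leUx.

Fact prod_le0x f : prod_bot <= f.
Proof. by apply/asboolP => i; exact: le0x. Qed.

Fact prod_lex1 f : f <= prod_top.
Proof. by apply/asboolP => i; exact: lex1. Qed.

HB.instance Definition _ := Order.hasBottom.Build d P prod_le0x.
HB.instance Definition _ := Order.hasTop.Build d P prod_lex1.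

Fact prod_odotA : associative prod_odot.
Proof. by move=> f g h; apply: functional_extensionality_dep => i; exact: odotA. Qed.

Fact prod_odotC : commutative prod_odot.
Proof. by move=> f g; apply: functional_extensionality_dep => i; exact: odotC. Qed.

Fact prod_odot1x : left_id (\top : P) prod_odot.
Proof. by move=> f; apply: functional_extensionality_dep => i; exact: odot1x. Qed.

Fact prod_residuation f g h : (prod_odot f g <= h) = (f <= prod_imp g h).
Proof.
by apply/asboolP/asboolP => fgh i; move: (fgh i);
  rewrite /prod_odot /prod_imp odot_residuation.
Qed.

Fact prod_prelinear f g : prod_imp f g `|` prod_imp g f = \top.
Proof. by apply: functional_extensionality_dep => i; exact: imp_prelinear. Qed.

HB.instance Definition _ := TBLattice_isMTL.Build d P
  prod_odotA prod_odotC prod_odot1x prod_residuation prod_prelinear.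

Fact prod_univ_le f : prod_univ f <= f.
Proof. by apply/asboolP => i; exact: univ_le. Qed.

Fact prod_univ_imp_imp f g :
  prod_univ (imp (imp f (prod_univ g)) (prod_univ g)) =
  imp (imp (prod_univ f) (prod_univ g)) (prod_univ g).
Proof. by apply: functional_extensionality_dep => i; exact: univ_imp_imp. Qed.

Fact prod_univ_imp f g :
  prod_univ (imp (prod_univ f) g) = imp (prod_univ f) (prod_univ g).
Proof. by apply: functional_extensionality_dep => i; exact: univ_imp. Qed.

HB.instance Definition _ := MTL_isUMTL.Build d P
  prod_univ_le prod_univ_imp_imp prod_univ_imp.

End Product.

(* L is isomorphic to a subalgebra of the product of the A i which projects
   onto every factor.  The index type may be empty (its product is then the
   one-element algebra). *)
Definition subdirect_product (d : Order.disp_t) (L : umtlType d) (I : Type)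
    (A : I -> umtlType d) : Prop :=
  exists h : L -> umtl_prod A,
    [/\ U_hom h, injective h & forall (i : I) (a : A i), exists x : L, h x i = a].

(* Main.v *)
Require Import Defs.
From mathcomp Require Import all_boot all_order.
From HB Require Import structures.
From mathcomp Require Import generic_quotient boolp classical_sets.

(** The two sides meet in one statement (maximal_kernelP): for a surjective
    U-homomorphism f : L -> M, the kernel of f is a maximal U-congruence of L
    if and only if M is simple.  This is the correspondence theorem: the
    U-congruences of L above the kernel are the U-congruences of M, and these
    are the U-filters of M.  Only two fragments of that correspondence are
    needed.  A U-filter F of M gives the U-congruence of mutual implication
    modulo F (filter_congruence), whose pullback to L lies above the kernel;
    so if the kernel is maximal, F is trivial.  A U-congruence E above the
    kernel gives the U-filter of images of the E-class of 1
    (image_class_filter); so if M is simple, E is the kernel or total.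

    If L is semisimple, its quotients by the maximal U-congruences are simple,
    since these congruences are the kernels of the projections; the
    projections separate the points of L because the maximal U-congruences
    intersect in the diagonal, and so L is a subdirect product of these
    quotients.  Conversely, the coordinate maps of a subdirect representation
    over simple algebras are surjective, so their kernels are maximal
    U-congruences, and injectivity says that already these kernels intersect
    in the diagonal. *)

Set Implicit Arguments.
Unset Strict Implicit.
Unset Printing Implicit Defensive.

Import Order.TTheory.

Local Open Scope quotient_scope.
Local Open Scope classical_set_scope.
Local Open Scope order_scope.

(** * Residuation *)

Section Residuation.
Variables (d : Order.disp_t) (L : mtlType d).
Implicit Types x y z : L.

Lemma odotx1 x : odot x \top = x.
Proof. by rewrite odotC odot1x. Qed.

Lemma odot_imp_le x y : odot (imp x y) x <= y.
Proof. by rewrite odot_residuation. Qed.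

Lemma le_odotr x y z : x <= y -> odot x z <= odot y z.
Proof.
by move=> xy; rewrite odot_residuation (le_trans xy) // -odot_residuation.
Qed.

Lemma le_odot x x' y y' : x <= x' -> y <= y' -> odot x y <= odot x' y'.
Proof.
move=> xx' yy'; apply: le_trans (le_odotr _ xx') _.
by rewrite ![odot x' _]odotC le_odotr.
Qed.

Lemma odot_lel x y : odot x y <= x.
Proof. by rewrite -[leRHS]odotx1 le_odot // lex1. Qed.

Lemma odot_ler x y : odot x y <= y.
Proof. by rewrite odotC odot_lel. Qed.

Lemma odot0x x : odot \bot x = \bot.
Proof. by apply/eqP; rewrite -lex0 odot_lel. Qed.

Lemma imp_top x y : (imp x y = \top) <-> x <= y.
Proof.
split=> [xy|xy]; first by rewrite -[x]odot1x odot_residuation xy.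
by apply/eqP; rewrite -le1x -odot_residuation odot1x.
Qed.

Lemma imp_xx x : imp x x = \top.
Proof. exact/imp_top. Qed.

Lemma imp_1x x : imp \top x = x.
Proof.
apply/le_anti/andP; split; last by rewrite -odot_residuation odotx1.
by rewrite -[imp _ _]odotx1 odot_imp_le.
Qed.

Lemma odot_imp_trans x y z : odot (imp x y) (imp y z) <= imp x z.
Proof.
rewrite -odot_residuation [odot (imp x y) _]odotC -odotA.
exact: le_trans (le_odot (lexx _) (odot_imp_le _ _)) (odot_imp_le _ _).
Qed.

Lemma imp_curry x y z : imp (odot x y) z = imp x (imp y z).
Proof.
apply/le_anti/andP; split.
  by rewrite -odot_residuation -odot_residuation -odotA odot_residuation.
by rewrite -odot_residuation odotA odot_residuation odot_residuation.
Qed.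

(** This inequality and the next three make the relation of implication modulo
    a filter compatible with the operations: a filter containing both factors
    on the left contains the implication on the right. *)
Lemma odot_imp_meet x x' y y' :
  odot (imp x x') (imp y y') <= imp (x `&` y) (x' `&` y').
Proof.
rewrite -odot_residuation lexI; apply/andP; split.
  exact: le_trans (le_odot (odot_lel _ _) (leIl _ _)) (odot_imp_le _ _).
exact: le_trans (le_odot (odot_ler _ _) (leIr _ _)) (odot_imp_le _ _).
Qed.

Lemma odot_imp_join x x' y y' :
  odot (imp x x') (imp y y') <= imp (x `|` y) (x' `|` y').
Proof.
(* Products distribute over joins because they are left adjoints: moving the
   join across the adjunction splits it into two cases. *)
rewrite -odot_residuation odotC odot_residuation leUx.
rewrite -!odot_residuation ![odot _ (odot _ _)]odotC.
apply/andP; split.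
  apply: le_trans (le_odotr _ (odot_lel _ _)) _.
  exact: le_trans (odot_imp_le _ _) (leUl _ _).
apply: le_trans (le_odotr _ (odot_ler _ _)) _.
exact: le_trans (odot_imp_le _ _) (leUr _ _).
Qed.

Lemma odot_imp_odot x x' y y' :
  odot (imp x x') (imp y y') <= imp (odot x y) (odot x' y').
Proof.
rewrite -odot_residuation.
have -> : odot (odot (imp x x') (imp y y')) (odot x y) =
          odot (odot (imp x x') x) (odot (imp y y') y).
  by rewrite !odotA -[odot (odot _ (imp y y')) x]odotA
             [odot (imp y y') x]odotC !odotA.
by apply: le_odot; apply: odot_imp_le.
Qed.

(** Implication is antitone on the left, whence imp x' x. *)
Lemma odot_imp_imp x x' y y' :
  odot (imp x' x) (imp y y') <= imp (imp x y) (imp x' y').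
Proof.
rewrite -odot_residuation -odotA [odot (imp y y') _]odotC odotA.
exact: le_trans (le_odotr _ (odot_imp_trans _ _ _)) (odot_imp_trans _ _ _).
Qed.

End Residuation.

(** * The universal quantifier *)

Section Quantifier.
Variables (d : Order.disp_t) (L : umtlType d).
Implicit Types x y : L.

(** This fact and the next come from the axiom on univ (imp (univ x) y) applied where
    univ x <= y, so that the inner implication is 1. *)
Lemma univ_top : univ (\top : L) = \top.
Proof. by rewrite -{1}(iffRL (imp_top _ _) (univ_le \top)) univ_imp imp_xx. Qed.

Lemma le_univ x y : x <= y -> univ x <= univ y.
Proof.
move=> xy; apply/imp_top; rewrite -univ_imp.
by rewrite (iffRL (imp_top _ _) (le_trans (univ_le x) xy)) univ_top.
Qed.

Lemma univ_imp_le x y : univ (imp x y) <= imp (univ x) (univ y).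
Proof.
rewrite -univ_imp le_univ // -odot_residuation.
exact: le_trans (le_odot (lexx _) (univ_le x)) (odot_imp_le _ _).
Qed.

End Quantifier.

(** * Filters and congruences *)

Section FilterCongruence.
Variables (d : Order.disp_t) (L : umtlType d).
Implicit Types (x y : L) (F : set L) (E : set (L * L)).

Lemma filter_le F x y : mtl_filter F -> F x -> x <= y -> F y.
Proof. by move=> [F1 Fmp] Fx /imp_top xy; apply: (Fmp x); rewrite ?xy. Qed.

Lemma filter_odot_le F x y z :
  mtl_filter F -> F x -> F y -> odot x y <= z -> F z.
Proof.
move=> fF Fx Fy; rewrite odot_residuation => xyz.
exact: fF.2 Fy (filter_le fF Fx xyz).
Qed.

(** A filter carries the implications compatible with each operation; the
    quantifier is covered because F is closed under it and it distributes over
    implication up to inequality. *)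
Lemma filter_congruence F : U_filter F ->
  U_congruence [set p | F (imp p.1 p.2) /\ F (imp p.2 p.1)].
Proof.
move=> [fF Funiv]; have FM := filter_odot_le fF.
split=> /=.
- by move=> x; rewrite imp_xx; split; exact: fF.1.
- by move=> x y [].
- move=> x y z [xy yx] [yz zy].
  by split; [apply: FM xy yz _ | apply: FM zy yx _]; exact: odot_imp_trans.
- move=> x x' y y' [xx' x'x] [yy' y'y].
  by split; [apply: FM xx' yy' _ | apply: FM x'x y'y _]; exact: odot_imp_meet.
- move=> x x' y y' [xx' x'x] [yy' y'y].
  by split; [apply: FM xx' yy' _ | apply: FM x'x y'y _]; exact: odot_imp_join.
- move=> x x' y y' [xx' x'x] [yy' y'y].
  by split; [apply: FM xx' yy' _ | apply: FM x'x y'y _]; exact: odot_imp_odot.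
- move=> x x' y y' [xx' x'x] [yy' y'y].
  by split; [apply: FM x'x yy' _ | apply: FM xx' y'y _]; exact: odot_imp_imp.
- move=> x x' [/Funiv xx' /Funiv x'x].
  by split; [apply: filter_le fF xx' _ | apply: filter_le fF x'x _];
    exact: univ_imp_le.
Qed.

Lemma U_filter_set1 : U_filter [set \top : L].
Proof.
split; first split=> // x y -> /=; first by rewrite imp_1x.
by move=> x ->; exact: univ_top.
Qed.

Lemma U_filter_setT : U_filter [set: L].
Proof. by []. Qed.

(** Multiplying a pair of related elements 0 and 1 by x relates 0 to x. *)
Lemma congruence_total E :
  U_congruence E -> E (\bot, \top) -> E = [set: L * L].
Proof.
move=> cE E01; have E0 x : E (\bot, x).
  by have := cong_odot cE E01 (cong_refl cE x); rewrite odot0x odot1x.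
apply/seteqP; split=> // -[x y] _.
exact: (cong_trans cE (cong_sym cE (E0 x)) (E0 y)).
Qed.

End FilterCongruence.

(** * Kernels of surjective homomorphisms *)

Section Kernel.
Variables (d d' : Order.disp_t) (L : umtlType d) (M : umtlType d').
Variable f : L -> M.
Hypotheses (homf : U_hom f) (surjf : forall b, exists x, f x = b).

Let ker : set (L * L) := [set p | f p.1 = f p.2].

Lemma pullback_congruence (E : set (M * M)) :
  U_congruence E -> U_congruence [set p | E (f p.1, f p.2)].
Proof.
case: homf => _ _ fI fU fM fimp funiv [cR cS cT cI cU cM cimp cuniv]; split=> /=.
- by move=> x; exact: cR.
- by move=> x y; exact: cS.
- by move=> x y z; exact: cT.
- by move=> *; rewrite !fI; exact: cI.
- by move=> *; rewrite !fU; exact: cU.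
- by move=> *; rewrite !fM; exact: cM.
- by move=> *; rewrite !fimp; exact: cimp.
- by move=> *; rewrite !funiv; exact: cuniv.
Qed.

Lemma kernel_congruence : U_congruence ker.
Proof.
case: homf => _ _ fI fU fM fimp funiv; split; rewrite /ker /=.
- by [].
- by move=> x y ->.
- by move=> x y z ->.
- by move=> x x' y y' ex ey; rewrite !fI ex ey.
- by move=> x x' y y' ex ey; rewrite !fU ex ey.
- by move=> x x' y y' ex ey; rewrite !fM ex ey.
- by move=> x x' y y' ex ey; rewrite !fimp ex ey.
- by move=> x x' ex; rewrite !funiv ex.
Qed.

(** Closure under detachment is where the kernel has to lie below E: the two
    premises are images of elements x and z of the class of 1 with z and
    imp x y having the same image, and then E relates imp x y to z. *)
Lemma image_class_filter (E : set (L * L)) :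
  U_congruence E -> ker `<=` E -> U_filter (f @` [set x | E (x, \top)]).
Proof.
move=> cE kerE; split; first split.
- by exists \top; [exact: (cong_refl cE)|exact: hom_top homf].
- move=> _ b [x /= Ex <-] [z /= Ez]; have [y <-] := surjf b.
  rewrite -(hom_imp homf) => fz; exists y => //=.
  have Exy : E (imp x y, \top).
    apply: (cong_trans cE) Ez; apply: (cong_sym cE); exact: kerE.
  have := cong_imp cE Ex (cong_refl cE y); rewrite imp_1x => /(cong_sym cE) Ey.
  exact: (cong_trans cE Ey Exy).
- move=> _ [x /= Ex <-]; exists (univ x); last exact: (hom_univ homf).
  by have := cong_univ cE Ex; rewrite univ_top.
Qed.

Lemma simple_maximal_kernel : umtl_simple M -> maximal_U_congruence ker.
Proof.
move=> [sM ntM]; split; first split; first exact: kernel_congruence.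
  (* A total kernel would identify 0 and 1 in M. *)
  move=> kerT; apply: ntM; apply/seteqP; split=> // b _ /=.
  have : ker (\bot, \top) by rewrite kerT.
  rewrite /ker /= (hom_bot homf) (hom_top homf) => b01.
  by apply/eqP; rewrite -le1x -b01 le0x.
move=> E [cE EnT] [kerE nEker].
have : [set F | U_filter F] (f @` [set x | E (x, \top)]).
  exact: image_class_filter.
rewrite sM => -[F1|FT].
  (* E relates imp u v to 1 whenever it relates u to v. *)
  apply: nEker => -[x y] Exy.
  have le_of u v : E (u, v) -> f u <= f v.
    move=> Euv; apply/imp_top; rewrite -(hom_imp homf).
    have : (f @` [set x | E (x, \top)]) (f (imp u v)).
      exists (imp u v) => //=.
      by have := cong_imp cE Euv (cong_refl cE v); rewrite imp_xx.
    by rewrite F1.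
  apply/le_anti; rewrite !le_of //; exact: (cong_sym cE Exy).
apply: EnT; apply: (congruence_total cE).
have [x /= Ex fx] : (f @` [set x | E (x, \top)]) \bot by rewrite FT.
apply: (cong_trans cE) Ex; apply: kerE.
by rewrite /ker /= (hom_bot homf) fx.
Qed.

(** A U-filter F of M other than {1} pulls back to a U-congruence strictly above
    the kernel, which is total by maximality; hence F contains 0. *)
Lemma maximal_kernel_simple : maximal_U_congruence ker -> umtl_simple M.
Proof.
move=> [[cker kerNT] kermax]; split; last first.
  move=> M1; apply: kerNT; apply/seteqP; split=> // -[x y] _ /=.
  have all1 (b : M) : b = \top by change ([set \top : M] b); rewrite M1.
  by rewrite /ker /= (all1 (f x)) (all1 (f y)).
apply/seteqP; split=> [F uF|F [->|->]]; last 2 first.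
- exact: U_filter_set1.
- exact: U_filter_setT.
apply: contrapT => /not_orP [Fn1 FnT].
have fF := uF.1.
pose E := [set p : L * L | F (imp (f p.1) (f p.2)) /\ F (imp (f p.2) (f p.1))].
have cE : U_congruence E := pullback_congruence (filter_congruence uF).
apply: (kermax E); first split=> // ET.
  have [] : E (\top, \bot) by rewrite ET.
  rewrite /= (hom_top homf) (hom_bot homf) imp_1x => F0 _.
  apply: FnT; apply/seteqP; split=> // b _.
  exact: filter_le fF F0 (le0x b).
split=> [[x y]|Eker].
  by rewrite /ker /E /= => ->; rewrite imp_xx; split; exact: fF.1.
apply: Fn1; apply/seteqP; split=> [b Fb|b -> /=]; last exact: fF.1.
have [x fx] := surjf b.
have /Eker : E (x, \top).
  rewrite /E /= (hom_top homf) fx imp_1x; split=> //.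
  by rewrite (iffRL (imp_top _ _) (lex1 b)); exact: fF.1.
by rewrite /ker /= fx (hom_top homf).
Qed.

Lemma maximal_kernelP : maximal_U_congruence ker <-> umtl_simple M.
Proof. by split; [exact: maximal_kernel_simple|exact: simple_maximal_kernel]. Qed.

End Kernel.

(** * Quotient algebras *)

Section Quotient.
Variables (d : Order.disp_t) (L : umtlType d) (E : set (L * L)).
Hypothesis cE : U_congruence E.

Definition congruence_rel : rel L := fun x y => `[< E (x, y) >].

Fact congruence_rel_refl : reflexive congruence_rel.
Proof. by move=> x; apply/asboolP; exact: (cong_refl cE x). Qed.

Fact congruence_rel_sym : symmetric congruence_rel.
Proof.
by move=> x y; apply/asboolP/asboolP; apply: (cong_sym cE).
Qed.

Fact congruence_rel_trans : transitive congruence_rel.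
Proof.
move=> y x z /asboolP xy /asboolP yz; apply/asboolP.
exact: (cong_trans cE xy yz).
Qed.

Canonical congruence_equiv := EquivRel congruence_rel
  congruence_rel_refl congruence_rel_sym congruence_rel_trans.

Definition umtl_quotient : Type := {eq_quot congruence_equiv}.
Local Notation Q := umtl_quotient.

HB.instance Definition _ := Choice.on Q.

Definition quotient_class (x : L) : Q := \pi_({eq_quot congruence_equiv}) x.
Local Notation cl := quotient_class.
Definition quotient_repr (a : Q) : L := repr (a : {eq_quot congruence_equiv}).

Lemma quotient_classP x y : cl x = cl y <-> E (x, y).
Proof. by split=> [/eqmodP /asboolP|xy]; last exact/eqmodP/asboolP. Qed.

Lemma quotient_reprK a : cl (quotient_repr a) = a.
Proof. exact: reprK. Qed.

Lemma quotient_repr_class x : E (quotient_repr (cl x), x).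
Proof. by apply/quotient_classP; rewrite quotient_reprK. Qed.

Lemma quotient_ind (P : Q -> Prop) : (forall x, P (cl x)) -> forall a, P a.
Proof. by move=> Pcl a; rewrite -[a]quotient_reprK. Qed.

Definition quotient_op2 (op : L -> L -> L) (a b : Q) : Q :=
  cl (op (quotient_repr a) (quotient_repr b)).
Definition quotient_univ (a : Q) : Q := cl (univ (quotient_repr a)).

Lemma quotient_op2E (op : L -> L -> L) :
  (forall x x' y y', E (x, x') -> E (y, y') -> E (op x y, op x' y')) ->
  forall x y, quotient_op2 op (cl x) (cl y) = cl (op x y).
Proof.
by move=> cop x y; apply/quotient_classP/cop; exact: quotient_repr_class.
Qed.

Definition quotient_meet := quotient_op2 Order.meet.
Definition quotient_join := quotient_op2 Order.join.
Definition quotient_odot := quotient_op2 odot.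
Definition quotient_imp := quotient_op2 imp.

Let meetE x y : quotient_meet (cl x) (cl y) = cl (x `&` y).
Proof. exact: (quotient_op2E (cong_meet cE)). Qed.
Let joinE x y : quotient_join (cl x) (cl y) = cl (x `|` y).
Proof. exact: (quotient_op2E (cong_join cE)). Qed.
Let odotE x y : quotient_odot (cl x) (cl y) = cl (odot x y).
Proof. exact: (quotient_op2E (cong_odot cE)). Qed.
Let impE x y : quotient_imp (cl x) (cl y) = cl (imp x y).
Proof. exact: (quotient_op2E (cong_imp cE)). Qed.

Lemma quotient_univE x : quotient_univ (cl x) = cl (univ x).
Proof.
apply/quotient_classP/(cong_univ cE); exact: quotient_repr_class.
Qed.

(** The order is read off the meet, so that the lattice laws of the quotient
    are images of equations of L. *)
Definition quotient_le : rel Q := fun a b => quotient_meet a b == a.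

Fact quotient_meetC : commutative quotient_meet.
Proof.
by elim/quotient_ind=> x; elim/quotient_ind=> y; rewrite !meetE meetC.
Qed.

Fact quotient_joinC : commutative quotient_join.
Proof.
by elim/quotient_ind=> x; elim/quotient_ind=> y; rewrite !joinE joinC.
Qed.

Fact quotient_meetA : associative quotient_meet.
Proof.
elim/quotient_ind=> x; elim/quotient_ind=> y; elim/quotient_ind=> z.
by rewrite !meetE meetA.
Qed.

Fact quotient_joinA : associative quotient_join.
Proof.
elim/quotient_ind=> x; elim/quotient_ind=> y; elim/quotient_ind=> z.
by rewrite !joinE joinA.
Qed.

Fact quotient_joinKI b a : quotient_meet a (quotient_join a b) = a.
Proof.
elim/quotient_ind: a => x; elim/quotient_ind: b => y.
by rewrite joinE meetE joinKI.
Qed.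

Fact quotient_meetKU b a : quotient_join a (quotient_meet a b) = a.
Proof.
elim/quotient_ind: a => x; elim/quotient_ind: b => y.
by rewrite meetE joinE meetKU.
Qed.

Fact quotient_le_refl : reflexive quotient_le.
Proof.
elim/quotient_ind=> x; apply/eqP.
by rewrite meetE meetxx.
Qed.

Fact quotient_le_anti : antisymmetric quotient_le.
Proof.
by move=> a b /andP[/eqP ab /eqP ba]; rewrite -ab quotient_meetC.
Qed.

Fact quotient_le_trans : transitive quotient_le.
Proof.
move=> b a c /eqP ab /eqP bc; apply/eqP.
by rewrite -{1}ab -quotient_meetA bc.
Qed.

HB.instance Definition _ :=
  Order.Le_isPOrder.Build d Q
    quotient_le_refl quotient_le_anti quotient_le_trans.

Fact quotient_leEmeet (a b : Q) : (a <= b) = (quotient_meet a b == a).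
Proof. by []. Qed.

HB.instance Definition _ := Order.POrder_isLattice.Build d Q
  quotient_meetC quotient_joinC quotient_meetA quotient_joinA
  quotient_joinKI quotient_meetKU quotient_leEmeet.

Fact quotient_le0x (a : Q) : cl \bot <= a.
Proof.
elim/quotient_ind: a => x.
by rewrite quotient_leEmeet meetE meet0x.
Qed.

Fact quotient_lex1 (a : Q) : a <= cl \top.
Proof.
elim/quotient_ind: a => x.
by rewrite quotient_leEmeet meetE meetx1.
Qed.

HB.instance Definition _ := Order.hasBottom.Build d Q quotient_le0x.
HB.instance Definition _ := Order.hasTop.Build d Q quotient_lex1.

Fact quotient_odotA : associative quotient_odot.
Proof.
elim/quotient_ind=> x; elim/quotient_ind=> y; elim/quotient_ind=> z.
by rewrite !odotE odotA.
Qed.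

Fact quotient_odotC : commutative quotient_odot.
Proof.
by elim/quotient_ind=> x; elim/quotient_ind=> y; rewrite !odotE odotC.
Qed.

Fact quotient_odot1x : left_id (\top : Q) quotient_odot.
Proof.
by elim/quotient_ind=> x; rewrite odotE odot1x.
Qed.

(** The order of the quotient is containment of the implication in the class
    of 1.  Residuation in the quotient then follows from the currying
    identity for implication. *)
Lemma quotient_leE x y : (cl x <= cl y) <-> E (imp x y, \top).
Proof.
rewrite quotient_leEmeet meetE.
split=> [/eqP /quotient_classP xy|xy].
  have := cong_imp cE xy (cong_refl cE y).
  rewrite (iffRL (imp_top _ _) (leIr y x)).
  exact: (cong_sym cE).
(* x is congruent to its product with imp x y, which lies below y. *)
have xr : E (odot (imp x y) x, x).
  by have := cong_odot cE xy (cong_refl cE x); rewrite odot1x.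
apply/eqP/quotient_classP.
have := cong_meet cE xr (cong_refl cE y).
rewrite (meet_l (odot_imp_le x y)) => /(cong_sym cE) xyr.
exact: (cong_trans cE xyr xr).
Qed.

Fact quotient_residuation (a b c : Q) :
  (quotient_odot a b <= c) = (a <= quotient_imp b c).
Proof.
elim/quotient_ind: a => x; elim/quotient_ind: b => y; elim/quotient_ind: c => z.
rewrite odotE impE.
by apply/idP/idP => /quotient_leE le1; apply/quotient_leE;
  rewrite ?imp_curry // -imp_curry.
Qed.

Fact quotient_prelinear (a b : Q) :
  quotient_imp a b `|` quotient_imp b a = \top.
Proof.
elim/quotient_ind: a => x; elim/quotient_ind: b => y.
rewrite !impE; transitivity (cl (imp x y `|` imp y x)).
  exact: joinE.
by rewrite imp_prelinear.
Qed.

HB.instance Definition _ := TBLattice_isMTL.Build d Q quotient_odotA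
  quotient_odotC quotient_odot1x quotient_residuation quotient_prelinear.

Fact quotient_univ_le (a : Q) : quotient_univ a <= a.
Proof.
elim/quotient_ind: a => x; rewrite quotient_univE; apply/quotient_leE.
by rewrite (iffRL (imp_top _ _) (univ_le x)); exact: (cong_refl cE _).
Qed.

Fact quotient_univ_imp_imp (a b : Q) :
  quotient_univ (imp (imp a (quotient_univ b)) (quotient_univ b)) =
  imp (imp (quotient_univ a) (quotient_univ b)) (quotient_univ b).
Proof.
have iE x y : imp (cl x) (cl y) = cl (imp x y) by exact: impE.
elim/quotient_ind: a => x; elim/quotient_ind: b => y.
by rewrite (quotient_univE x) (quotient_univE y) !iE quotient_univE univ_imp_imp.
Qed.

Fact quotient_univ_imp (a b : Q) :
  quotient_univ (imp (quotient_univ a) b) =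
  imp (quotient_univ a) (quotient_univ b).
Proof.
have iE x y : imp (cl x) (cl y) = cl (imp x y) by exact: impE.
elim/quotient_ind: a => x; elim/quotient_ind: b => y.
by rewrite (quotient_univE x) (quotient_univE y) !iE quotient_univE univ_imp.
Qed.

HB.instance Definition _ := MTL_isUMTL.Build d Q
  quotient_univ_le quotient_univ_imp_imp quotient_univ_imp.

Lemma quotient_class_hom : U_hom (cl : L -> Q).
Proof.
split=> [||x y|x y|x y|x y|x].
- by [].
- by [].
- exact: (esym (meetE x y)).
- exact: (esym (joinE x y)).
- exact: (esym (odotE x y)).
- exact: (esym (impE x y)).
- exact: (esym (quotient_univE x)).
Qed.

Lemma quotient_class_surj (a : Q) : exists x, cl x = a.
Proof. by exists (quotient_repr a); exact: quotient_reprK. Qed.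

Lemma quotient_simple : maximal_U_congruence E -> umtl_simple (Q : umtlType d).
Proof.
move=> maxE; apply/(maximal_kernelP quotient_class_hom quotient_class_surj).
suff -> : [set p | cl p.1 = cl p.2] = E by [].
by apply/seteqP; split=> -[x y] /quotient_classP.
Qed.

End Quotient.

(** * Subdirect representations *)

Section Subdirect.
Variables (d : Order.disp_t) (L : umtlType d).

Lemma coordinate_hom (I : Type) (A : I -> umtlType d) (h : L -> umtl_prod A) :
  U_hom h -> forall i, U_hom (fun x => h x i).
Proof.
case=> h0 h1 hI hU hM himp huniv i; split.
- by rewrite h0.
- by rewrite h1.
- by move=> x y; rewrite hI.
- by move=> x y; rewrite hU.
- by move=> x y; rewrite hM.
- by move=> x y; rewrite himp.
- by move=> x; rewrite huniv.
Qed.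

(** Only the kernels of the coordinate maps are tested: they are maximal, and
    two elements that they all relate have the same image under h. *)
Lemma subdirect_simple_semisimple (I : Type) (A : I -> umtlType d) :
  (forall i, umtl_simple (A i)) -> subdirect_product L A -> umtl_semisimple L.
Proof.
move=> sA [h [homh injh surjh]]; apply/seteqP; split=> -[x y].
  move=> capxy; apply: injh; apply: functional_extensionality_dep => i.
  apply: (capxy [set p | h p.1 i = h p.2 i]).
  exact/(maximal_kernelP (coordinate_hom homh i) (surjh i)).
by move=> /diagonalP -> E [[cE _] _]; exact: (cong_refl cE _).
Qed.

(** The tuple of projections onto the quotients by the maximal U-congruences is
    injective exactly because these congruences intersect in the diagonal. *)
Lemma semisimple_subdirect_simple : umtl_semisimple L ->
  exists (I : Type) (A : I -> umtlType d),
    (forall i, umtl_simple (A i)) /\ subdirect_product L A.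
Proof.
move=> ssL; pose I := {E : set (L * L) | maximal_U_congruence E}.
have cI (i : I) : U_congruence (sval i) by case: i => E [[]].
exists I, (fun i => umtl_quotient (cI i) : umtlType d); split=> [i|].
  exact: quotient_simple (svalP i).
exists (fun x i => quotient_class (cI i) x); split.
- by split=> [||x y|x y|x y|x y|x]; apply: functional_extensionality_dep => i;
    have [] := quotient_class_hom (cI i).
- have [capE _] := iffLR (seteqP _ _) ssL.
  move=> x y hxy; apply: (capE (x, y)) => E maxE.
  apply/(quotient_classP (cI (exist _ E maxE))).
  exact: (congr1 (fun g => g (exist _ E maxE)) hxy).
- by move=> i a; exact: quotient_class_surj.
Qed.

End Subdirect.

Close Scope classical_set_scope.
Close Scope order_scope.

Theorem theorem4p18 (d : Order.disp_t) (L : umtlType d) :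
  umtl_semisimple L <->
  exists (I : Type) (A : I -> umtlType d),
    (forall i : I, umtl_simple (A i)) /\ subdirect_product L A.
Proof.
split; first exact: semisimple_subdirect_simple.
by move=> [I [A [sA subA]]]; exact: subdirect_simple_semisimple sA subA.
Qed.
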